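(* Let $s=2$. The coefficients $\alpha,\beta^{(1)},\dots,\beta^{(4)}\in\mathbb{R}^2$, $A^{(q)},B^{(q)}\in\mathbb{R}^{2\times 2}$ ($q=0,1,2$, strictly lower triangular) of an explicit stochastic Runge--Kutta method satisfy conditions 1.--8. if and only if there are $c_1\in\{-1,1\}$ and $c_2,\dots,c_{11}\in\mathbb{R}$ with $c_2\neq 0$, $c_4c_{10}=0$ and $c_6c_{11}=0$ such that $$\alpha^T=\begin{bmatrix}1-\tfrac{1}{2c_2}&\tfrac{1}{2c_2}\end{bmatrix},\quad \beta^{(1)T}=\begin{bmatrix}c_1-c_4&c_4\end{bmatrix},\quad \beta^{(2)T}=\begin{bmatrix}c_5&-c_5\end{bmatrix},$$ $$\beta^{(3)T}=\begin{bmatrix}c_6&-c_6\end{bmatrix},\quad \beta^{(4)T}=\begin{bmatrix}c_7&-c_7\end{bmatrix},$$ $$A^{(0)}=\begin{bmatrix}0&0\\c_2&0\end{bmatrix},\quad A^{(1)}=\begin{bmatrix}0&0\\c_8&0\end{bmatrix},\quad A^{(2)}=\begin{bmatrix}0&0\\c_9&0\end{bmatrix},$$ $$B^{(0)}=\begin{bmatrix}0&0\\c_3&0\end{bmatrix},\quad B^{(1)}=\begin{bmatrix}0&0\\c_{10}&0\end{bmatrix},\quad B^{(2)}=\begin{bmatrix}0&0\\c_{11}&0\end{bmatrix}.$$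
   Context: An explicit $s$-stage stochastic Runge--Kutta (SRK) method of the class considered is determined by vectors $\alpha,\beta^{(1)},\beta^{(2)},\beta^{(3)},\beta^{(4)}\in\mathbb{R}^s$ and matrices $A^{(q)},B^{(q)}\in\mathbb{R}^{s\times s}$, $q=0,1,2$, with $A^{(q)}_{ij}=B^{(q)}_{ij}=0$ for $j\ge i$. Let $e=(1,\dots,1)^T\in\mathbb{R}^s$. ''Order (2,1)'' (deterministic order 2, weak stochastic order 1) is understood through the conditions: 1. $\alpha^Te=1$; 2. $\beta^{(4)T}e=0$; 3. $\beta^{(3)T}e=0$; 4. $(\beta^{(1)T}e)^2=1$; 5. $\beta^{(2)T}e=0$; 6. $\beta^{(1)T}B^{(1)}e=0$; 7. $\beta^{(3)T}B^{(2)}e=0$; 8. $\alpha^TA^{(0)}e=\tfrac12$. *)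

(* Defs.v *)
From mathcomp Require Import all_boot all_order all_algebra.
From mathcomp Require Import reals.

Set Implicit Arguments.
Unset Strict Implicit.
Unset Printing Implicit Defensive.

Import Order.TTheory GRing.Theory Num.Theory.
Local Open Scope ring_scope.

(* beta1, ..., beta4 are the weights $\beta^{(1)}, ..., \beta^{(4)}$ and
   A0, A1, A2, B0, B1, B2 the matrices $A^{(q)}$, $B^{(q)}$, q = 0, 1, 2.
   The shape of the matrices is not part of the record: see [explicit]. *)
Record srk_coeffs (R : realType) (s : nat) := SRKCoeffs {
  alpha : 'cV[R]_s;
  beta1 : 'cV[R]_s;
  beta2 : 'cV[R]_s;
  beta3 : 'cV[R]_s;
  beta4 : 'cV[R]_s;
  A0 : 'M[R]_s;
  A1 : 'M[R]_s;
  A2 : 'M[R]_s;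
  B0 : 'M[R]_s;
  B1 : 'M[R]_s;
  B2 : 'M[R]_s }.

Definition strictly_lower (R : realType) (s : nat) (M : 'M[R]_s) : Prop :=
  forall i j : 'I_s, (i <= j)%N -> M i j = 0.

Definition explicit (R : realType) (s : nat) (M : srk_coeffs R s) : Prop :=
  [/\ strictly_lower (A0 M), strictly_lower (A1 M) & strictly_lower (A2 M)] /\
  [/\ strictly_lower (B0 M), strictly_lower (B1 M) & strictly_lower (B2 M)].

Definition ones (R : realType) (s : nat) : 'cV[R]_s := const_mx 1.

(* The real number $u^T v$; the matrix product itself is a 1 x 1 matrix. *)
Definition dotc (R : realType) (s : nat) (u v : 'cV[R]_s) : R :=
  (u^T *m v) 0 0.

(* Deterministic order 2 and weak stochastic order 1, through the algebraic
   conditions on the coefficients. *)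
Record order21 (R : realType) (s : nat) (M : srk_coeffs R s) : Prop := Order21 {
  order21_1 : dotc (alpha M) (ones R s) = 1;
  order21_2 : dotc (beta4 M) (ones R s) = 0;
  order21_3 : dotc (beta3 M) (ones R s) = 0;
  order21_4 : dotc (beta1 M) (ones R s) ^+ 2 = 1;
  order21_5 : dotc (beta2 M) (ones R s) = 0;
  order21_6 : dotc (beta1 M) (B1 M *m ones R s) = 0;
  order21_7 : dotc (beta3 M) (B2 M *m ones R s) = 0;
  order21_8 : dotc (alpha M) (A0 M *m ones R s) = 1 / 2 }.

Definition row2 (R : realType) (a b : R) : 'rV[R]_2 :=
  \row_(j < 2) nth 0 [:: a; b] j.

(* The rows are (a b) and (c d). *)
Definition mat2 (R : realType) (a b c d : R) : 'M[R]_2 :=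
  \matrix_(i < 2, j < 2) nth 0 (nth [::] [:: [:: a; b]; [:: c; d]] i) j.

(* Main.v *)
Require Import Defs.
From mathcomp Require Import all_boot all_order all_algebra.
From mathcomp Require Import reals ring.

Set Implicit Arguments.
Unset Strict Implicit.
Unset Printing Implicit Defensive.

Import Order.TTheory GRing.Theory Num.Theory.
Local Open Scope ring_scope.

(** A strictly lower triangular 2 x 2 matrix has one free entry [m], and it sends the vector of ones
    to (0, m). Hence conditions 6 to 8 collapse to single products ([dotc_mat2_ones]), while the
    others only fix the sum of two weights ([dotc_ones2]). Condition 8 makes [c2] invertible and
    determines [alpha]; conditions 6 and 7 become [c4 * c10 = 0] and, up to sign, [c6 * c11 = 0].
    The remaining entries are free parameters. *)

Lemma tr_row2P (R : realType) (u : 'cV[R]_2) (a b : R) :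
  u^T = row2 a b <-> u 0 0 = a /\ u 1 0 = b.
Proof.
split=> [/rowP uE | [ua ub]].
  by have := uE 0; have := uE 1; rewrite !mxE => -> ->.
(* The destructed index and the literal ordinal share their value but not their bound proof, hence
   [val_inj]. *)
by apply/rowP=> -[[|[|//]] lt_i]; rewrite !mxE -?ua -?ub;
  congr (u _ _); apply/val_inj.
Qed.

Lemma strictly_lower_mat2 (R : realType) (M : 'M[R]_2) :
  strictly_lower M -> M = mat2 0 0 (M 1 0) 0.
Proof.
move=> lowM; apply/matrixP=> -[[|[|//]] lt_i] -[[|[|//]] lt_j];
  rewrite mxE /=; try exact: lowM.
by congr (M _ _); apply/val_inj.
Qed.

Lemma dotc_ones2 (R : realType) (u : 'cV[R]_2) :
  dotc u (ones R 2) = u 0 0 + u 1 0.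
Proof.
rewrite /dotc mxE !big_ord_recl big_ord0 !mxE !mulr1 addr0.
by congr (_ + u _ _); apply/val_inj.
Qed.

(** The first row of the matrix vanishes, so only the second weight of [u] survives. *)
Lemma dotc_mat2_ones (R : realType) (u : 'cV[R]_2) (c : R) :
  dotc u (mat2 0 0 c 0 *m ones R 2) = u 1 0 * c.
Proof.
rewrite /dotc mxE !big_ord_recl big_ord0 !mxE !big_ord_recl !big_ord0 !mxE /=.
rewrite !mul0r !mulr1 !addr0 mulr0 add0r.
by congr (u _ _ * _); apply/val_inj.
Qed.

Theorem mainTheorem2 (R : realType) (M : srk_coeffs R 2) (hM : explicit M) :
  order21 M <->
  exists c1 c2 c3 c4 c5 c6 c7 c8 c9 c10 c11 : R,
    [/\ c1 = -1 \/ c1 = 1, c2 != 0, c4 * c10 = 0 & c6 * c11 = 0] /\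
    [/\ (alpha M)^T = row2 (1 - 1 / (2 * c2)) (1 / (2 * c2)),
        (beta1 M)^T = row2 (c1 - c4) c4,
        (beta2 M)^T = row2 c5 (- c5),
        (beta3 M)^T = row2 c6 (- c6) &
        (beta4 M)^T = row2 c7 (- c7)] /\
    [/\ A0 M = mat2 0 0 c2 0,
        A1 M = mat2 0 0 c8 0 &
        A2 M = mat2 0 0 c9 0] /\
    [/\ B0 M = mat2 0 0 c3 0,
        B1 M = mat2 0 0 c10 0 &
        B2 M = mat2 0 0 c11 0].
Proof.
have [[/strictly_lower_mat2 A0E /strictly_lower_mat2 A1E
       /strictly_lower_mat2 A2E]
      [/strictly_lower_mat2 B0E /strictly_lower_mat2 B1E
       /strictly_lower_mat2 B2E]] := hM.
split.
  case; rewrite A0E B1E B2E !dotc_mat2_ones !dotc_ones2.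
  move=> a1 b4 b3 b1 b2 bB1 bB2 aA0.
  (* A zero entry would turn condition 8 into 0 = 1/2. *)
  have c2_neq0 : A0 M 1 0 != 0.
    apply: contra_eq_neq aA0 => ->.
    by rewrite mulr0 eq_sym mul1r invr_eq0 pnatr_eq0.
  have opp (x y : R) : x + y = 0 -> y = - x.
    by move/eqP; rewrite addrC addr_eq0 => /eqP.
  have alphaE : alpha M 1 0 = 1 / (2 * A0 M 1 0).
    by rewrite -[LHS](mulfK c2_neq0) aA0; field.
  (* Taking [c1] as the sum of the [beta1] weights makes condition 4 read [c1 ^+ 2 = 1]; the other
     parameters are entries of the coefficients. *)
  exists (beta1 M 0 0 + beta1 M 1 0), (A0 M 1 0), (B0 M 1 0), (beta1 M 1 0),
    (beta2 M 0 0), (beta3 M 0 0), (beta4 M 0 0), (A1 M 1 0), (A2 M 1 0),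
    (B1 M 1 0), (B2 M 1 0); split.
    split=> //.
      by move/eqP: b1; rewrite sqrf_eq1 => /orP[] /eqP ->; [right | left].
    (* Condition 7 involves the second weight of [beta3], which is [- c6] by condition 3. *)
    by apply: oppr_inj; rewrite -mulNr -(opp _ _ b3) bB2 oppr0.
  split; last by [].
  split; apply/tr_row2P; split=> //; try exact: opp.
    (* What remains is the first weight of [alpha] and of [beta1]: the sum minus the second
       weight. *)
    by rewrite -alphaE -a1 addrK.
  by rewrite addrK.
move=> [c1 [c2 [c3 [c4 [c5 [c6 [c7 [c8 [c9 [c10 [c11]]]]]]]]]]].
move=> [[c1E c2_neq0 c4c10 c6c11]].
move=> [[/tr_row2P[a0 a1] /tr_row2P[b10 b11] /tr_row2P[b20 b21]]].
move=> /tr_row2P[b30 b31] /tr_row2P[b40 b41] [[A0c _ _] [_ B1c B2c]].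
split; rewrite ?A0c ?B1c ?B2c ?dotc_mat2_ones ?dotc_ones2.
- by rewrite a0 a1 subrK.
- by rewrite b40 b41 subrr.
- by rewrite b30 b31 subrr.
- by rewrite b10 b11 subrK; case: c1E => ->; rewrite ?sqrrN expr1n.
- by rewrite b20 b21 subrr.
- by rewrite b11.
- by rewrite b31 mulNr c6c11 oppr0.
- by rewrite a1; field.
Qed.
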